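(* Let $W=\{(W_i,\omega_i)\}_{i\in I}$ be a fusion frame for an $n$-dimensional Hilbert space $\mathcal{H}_n$ (with $|I|<\infty$), let $\mathcal{A}:\bigoplus_{i\in I}W_i\to\mathcal{H}_n$ be a bounded left inverse of $T_W^*$, and let $V=\{(V_i,\upsilon_i)\}_{i\in I}$ be a $Q_{\mathcal{A}}$-dual fusion frame of $W$. Then $$\big|e(V)-e(W)\big|=\bigg|\sum_{i\in I}\dim\big(V_i\cap N(p_i\mathcal{A}^* )\big)-\sum_{i\in I}\dim N(\mathcal{A}p_i^* )\bigg|.$$ Moreover, if $V$ is a component preserving dual fusion frame of $W$ (that is, $Q_{\mathcal{A}}$ is component preserving), then $$\big|e(V)-e(W)\big|=\big|\dim N(Q_{\mathcal{A}}^* )-\dim N(Q_{\mathcal{A}})\big|.$$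
   Context: A family $W=\{(W_i,\omega_i)\}_{i\in I}$ of closed subspaces $W_i$ of a Hilbert space $\mathcal{H}$ and weights $\omega_i>0$ is a fusion frame for $\mathcal{H}$ if there are $0<A\le B<\infty$ with $A\|f\|^2\le\sum_{i\in I}\omega_i^2\|\pi_{W_i}f\|^2\le B\|f\|^2$ for all $f\in\mathcal{H}$, where $\pi_{W_i}$ is the orthogonal projection onto $W_i$. $\bigoplus_{i\in I}W_i$ denotes the Hilbert space of sequences $\{f_i\}_{i\in I}$ with $f_i\in W_i$ and $\sum_i\|f_i\|^2<\infty$, with inner product $\sum_i\langle f_i,g_i\rangle$. The synthesis operator is $T_W:\bigoplus_{i\in I}W_i\to\mathcal{H}$, $T_W\{f_i\}=\sum_i\omega_i f_i$, with adjoint $T_W^*f=\{\omega_i\pi_{W_i}f\}_{i\in I}$. The excess is $e(W)=\dim N(T_W)$; $N(\cdot)$ denotes the null space. Define $M_i:\bigoplus_kW_k\to\bigoplus_kW_k$ by $M_i\{f_j\}_{j\in I}=\{\delta_{i,j}f_j\}_{j\in I}$ (and similarly on $\bigoplus_kV_k$), and $p_i:\bigoplus_kW_k\to W_i$ by $p_i\{f_k\}=f_i$, with adjoint $p_i^*:W_i\to\bigoplus_kW_k$ (the canonical embedding). $\mathcal{L}_{T_W^*}$ is the set of bounded left inverses of $T_W^*$, i.e. bounded $\mathcal{A}$ with $\mathcal{A}T_W^*=I_{\mathcal{H}}$. A fusion frame $V=\{(V_i,\upsilon_i)\}_{i\in I}$ is a $Q$-dual fusion frame of $W$ if $Q:\bigoplus_iW_i\to\bigoplus_iV_i$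 is bounded, $T_VQT_W^*=I_{\mathcal{H}}$, and $Q$ is block-diagonal, meaning $QM_i(\bigoplus_kW_k)\subseteq M_i(\bigoplus_kV_k)$ for all $i$; it is component preserving if $QM_i(\bigoplus_kW_k)=M_i(\bigoplus_kV_k)$ for all $i$. For $\mathcal{A}\in\mathcal{L}_{T_W^*}$, ''$V$ is a $Q_{\mathcal{A}}$-dual fusion frame of $W$'' means that $\mathcal{A}M_i(\bigoplus_kW_k)\subseteq V_i$ for all $i\in I$ and that $Q_{\mathcal{A}}:\bigoplus_iW_i\to\bigoplus_iV_i$, $Q_{\mathcal{A}}\{f_j\}_{j\in I}=\{\upsilon_i^{-1}\mathcal{A}M_i\{f_j\}_{j\in I}\}_{i\in I}$, is a well-defined bounded operator for which the fusion frame $V$ is a (block-diagonal) $Q_{\mathcal{A}}$-dual of $W$. *)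

(* Defs.v *)
From HB Require Import structures.
From mathcomp Require Import all_boot all_order all_algebra.
From mathcomp Require Import complex.
From mathcomp Require Import boolp reals.

Set Implicit Arguments.
Unset Strict Implicit.
Unset Printing Implicit Defensive.

Import Order.TTheory GRing.Theory Num.Theory.

Local Open Scope ring_scope.

(* A finite-dimensional Hilbert space is a vectType over the real or complex  *)
(* numbers together with a positive definite form {dot H for conjugation},    *)
(* linear in its first argument and conjugate-linear in the second one.       *)
Inductive scalar_kind := RealScalars | ComplexScalars.

Definition scalars (R : realType) (k : scalar_kind) : numFieldType :=
  match k with RealScalars => R | ComplexScalars => R[i] end.

Definition conjugation (R : realType) (k : scalar_kind) :
    involutive_rmorphism (scalars R k) :=
  match k return involutive_rmorphism (scalars R k) with
  | RealScalars => @idfun R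
  | ComplexScalars => @Num.conj R[i]
  end.

(* The notions below make sense over any numFieldType with involution; norms  *)
(* occur only through their squares form u u. Subspaces of a space of finite  *)
(* dimension are closed, so closed subspaces are the elements of {vspace H}.  *)

Lemma linfun_linearE (K : nzRingType) (U V : vectType K) (f : U -> V) (u : U) :
  linear f -> linfun f u = f u.
Proof.
move=> fL; pose g : {linear U -> V} := HB.pack f (GRing.isLinear.Build _ _ _ _ f fL).
exact: (lfunE g).
Qed.

Section Adjoint.
Variables (K : numFieldType) (theta : involutive_rmorphism K).

Lemma dot_eq0 (U : vectType K) (fU : {dot U for theta}) (u : U) :
  (forall v, fU u v = 0) -> u = 0.
Proof.
move=> h; apply/eqP; apply: contraT => /(neq0_dnorm_gt0 (s := fU)).
by rewrite h ltxx.
Qed.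

Lemma dotC (U : vectType K) (fU : {dot U for theta}) (u v : U) :
  fU u v = theta (fU v u).
Proof. by rewrite (hermC fU) expr0 mul1r. Qed.

Variables (U V : vectType K).
Variables (fU : {dot U for theta}) (fV : {dot V for theta}).

Lemma adjoint_exists (T : 'Hom(U, V)) :
  exists S : 'Hom(V, U), forall u v, fV (T u) v = fU u (S v).
Proof.
pose b := vbasis {:U}; pose c := vbasis {:V}.
pose G := \matrix_(i, j) fU b`_i b`_j : 'M_(\dim {:U}).
have Gu : G \in unitmx.
  rewrite -row_free_unit; apply: inj_row_free => x xG.
  have u0 : \sum_i x 0 i *: b`_i = 0.
    apply: (dot_eq0 (fU := fU)) => v.
    rewrite (coord_vbasis (memvf v)) linear_sumr big1 // => j _.
    rewrite linearZr_LR/= -/b.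
    have := congr1 (fun M : 'rV_(\dim {:U}) => M 0 j) xG.
    rewrite !mxE linear_sumlz => /= h.
    rewrite [X in _ * X](_ : _ = 0) ?mulr0 // -[RHS]h.
    by apply: eq_bigr => i _; rewrite linearZl_LR !mxE.
  have /freeP bfree := basis_free (vbasisP {:U}).
  by apply/rowP => i; rewrite mxE (bfree (x 0)).
pose F := \matrix_(i < \dim {:U}, j < \dim {:V}) fV (T b`_i) c`_j.
pose M := invmx G *m F.
pose s v := \sum_j coord c j v *: \sum_k theta (M k j) *: b`_k.
have sL : linear s.
  move=> a v w; rewrite /s scaler_sumr -big_split/=.
  by apply: eq_bigr => j _; rewrite linearP scalerDl scalerA.
pose sl : {linear V -> U} := HB.pack s (GRing.isLinear.Build _ _ _ _ s sL).
exists (linfun sl) => u v; rewrite lfunE/= /s.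
rewrite [in LHS](coord_vbasis (memvf v)) !linear_sumr.
apply: eq_bigr => j _; rewrite !linearZr_LR/=; congr (_ * _).
rewrite (coord_vbasis (memvf u)) linear_sum !linear_sumlz.
apply: eq_bigr => i _; rewrite linearZ/= !linearZl_LR; congr (_ * _).
rewrite linear_sumr.
transitivity ((G *m M) i j); first by rewrite mulKVmx// mxE.
rewrite mxE; apply: eq_bigr => k _.
by rewrite linearZr_LR/= rmorphK mxE mulrC.
Qed.

Definition adjoint (T : 'Hom(U, V)) : 'Hom(V, U) :=
  projT1 (cid (adjoint_exists T)).

Lemma adjointP (T : 'Hom(U, V)) u v : fV (T u) v = fU u (adjoint T v).
Proof. exact: (projT2 (cid (adjoint_exists T))). Qed.

Lemma adjoint_unique (T : 'Hom(U, V)) (S : 'Hom(V, U)) :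
  (forall u v, fV (T u) v = fU u (S v)) -> S = adjoint T.
Proof.
move=> h; apply/lfunP => v; apply/eqP; rewrite -subr_eq0; apply/eqP.
apply: (dot_eq0 (fU := fU)) => u.
by rewrite dotC linearBr/= -adjointP -h subrr rmorph0.
Qed.

(* The bound |T u| <= C |u|, with both sides squared.                         *)
Definition bounded_op (T : 'Hom(U, V)) : Prop :=
  exists C : K, 0 <= C /\ forall u, fV (T u) (T u) <= C ^+ 2 * fU u u.

End Adjoint.

Section SubspaceDot.
Variables (K : numFieldType) (theta : involutive_rmorphism K).
Variables (H : vectType K) (form : {dot H for theta}) (W : {vspace H}).

Definition subvs_dot (u v : subvs_of W) : K := form (vsval u) (vsval v).

Lemma subvs_dot_bilinear : bilinear_for
  (GRing.Scale.Law.clone _ _ *%R _) (GRing.Scale.Law.clone _ _ (theta \; *%R) _)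
  subvs_dot.
Proof.
split=> [v|u] a x y.
- exact: (linearPl form).
- exact: (linearPr form).
Qed.

HB.instance Definition _ := bilinear_isBilinear.Build K _ _ _
  (GRing.Scale.Law.clone _ _ *%R _) (GRing.Scale.Law.clone _ _ (theta \; *%R) _)
  subvs_dot subvs_dot_bilinear.

Lemma subvs_dot_herm (u v : subvs_of W) :
  subvs_dot u v = (-1) ^+ false * theta (subvs_dot v u).
Proof. exact: hermC. Qed.

HB.instance Definition _ :=
  isHermitianSesquilinear.Build K _ false theta subvs_dot subvs_dot_herm.

Lemma subvs_dot_gt0 (u : subvs_of W) : u != 0 -> 0 < subvs_dot u u.
Proof.
by move=> u0; apply: neq0_dnorm_gt0; apply: contra_neq u0 => h; apply: val_inj.
Qed.

HB.instance Definition _ := isDotProduct.Build K _ subvs_dot subvs_dot_gt0.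

Definition orthoproj : 'End(H) := daddv_pi W (orthov form W).

Lemma capv_orthov : (W :&: orthov form W = 0)%VS.
Proof.
apply/eqP; rewrite -subv0; apply/subvP => u; rewrite memv_cap memv0.
case/andP=> uW /mem_orthovP/(_ u uW) fuu.
by apply: contraT => /(neq0_dnorm_gt0 (s := form)); rewrite fuu ltxx.
Qed.

Lemma orthoprojP (u : H) :
  orthoproj u \in W /\ forall x, x \in W -> form (u - orthoproj u) x = 0.
Proof.
split=> [|x xW]; first exact: memv_pi.
pose j : 'Hom(subvs_of W, H) := linfun vsval.
pose p := vsval (adjoint subvs_dot form j u).
have up x' : x' \in W -> form x' u = form x' p.
  move=> x'W; have := adjointP subvs_dot form j (Subvs x'W) u.
  by rewrite lfunE.
have pW : p \in W by apply: subvsP.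
have upO : u - p \in orthov form W.
  apply/mem_orthovP => y yW.
  apply: etrans (dotC form _ _) _.
  by rewrite linearBr/= up// subrr rmorph0.
suff -> : orthoproj u = p by apply: (mem_orthovP upO).
have capC : (orthov form W :&: W = 0)%VS by rewrite capvC capv_orthov.
rewrite -[u in LHS](subrK p) linearD/=.
rewrite [orthoproj p]daddv_pi_id ?capv_orthov//.
have upS : u - p \in (W + orthov form W)%VS.
  by apply: subvP upO; apply: addvSr.
have := daddv_pi_add capv_orthov upS.
rewrite (daddv_pi_id capC upO) => /(canRL (addrK _)).
by rewrite subrr => ->; rewrite add0r.
Qed.

End SubspaceDot.

Arguments subvs_dot {K theta H} form W u v.

Section DirectSum.
Variables (K : numFieldType) (theta : involutive_rmorphism K) (I : finType).
Variables (H : vectType K) (form : {dot H for theta}).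

Definition coordinate (i : I) (f : {ffun I -> H}) : H := f i.

Lemma coordinate_is_linear i : linear (coordinate i).
Proof. by move=> a f g; rewrite /coordinate !ffunE. Qed.

HB.instance Definition _ i :=
  GRing.isLinear.Build K _ _ _ (coordinate i) (coordinate_is_linear i).

Definition dsumv (W : I -> {vspace H}) : {vspace {ffun I -> H}} :=
  (\bigcap_i (linfun (coordinate i) @^-1: W i))%VS.

Lemma dsumvP (W : I -> {vspace H}) (f : {ffun I -> H}) :
  reflect (forall i, f i \in W i) (f \in dsumv W).
Proof.
rewrite memvE.
apply: (iffP subv_bigcapP) => h i; last first.
  by move=> _; rewrite -memvE -memv_preim lfunE; apply: h.
by have := h i isT; rewrite -memvE -memv_preim lfunE.
Qed.

(* I is finite, so the square-summability condition is void. *)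
Definition dsum (W : I -> {vspace H}) : vectType K := subvs_of (dsumv W).

Section Inner.
Variable W : I -> {vspace H}.

Definition dsum_dot (f g : dsum W) : K := \sum_i form (vsval f i) (vsval g i).

Lemma dsum_coordP (i : I) a (f g : dsum W) :
  vsval (a *: f + g) i = a *: vsval f i + vsval g i.
Proof. by rewrite linearP !ffunE. Qed.

Lemma dsum_dot_bilinear : bilinear_for
  (GRing.Scale.Law.clone _ _ *%R _) (GRing.Scale.Law.clone _ _ (theta \; *%R) _)
  dsum_dot.
Proof.
split=> [v|u] a x y; rewrite /dsum_dot /= mulr_sumr -big_split/=;
  apply: eq_bigr => i _; rewrite dsum_coordP.
- exact: (linearPl form).
- exact: (linearPr form).
Qed.

HB.instance Definition _ := bilinear_isBilinear.Build K _ _ _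
  (GRing.Scale.Law.clone _ _ *%R _) (GRing.Scale.Law.clone _ _ (theta \; *%R) _)
  dsum_dot dsum_dot_bilinear.

Lemma dsum_dot_herm (f g : dsum W) :
  dsum_dot f g = (-1) ^+ false * theta (dsum_dot g f).
Proof.
rewrite expr0 mul1r /dsum_dot rmorph_sum/=.
by apply: eq_bigr => i _; apply: dotC.
Qed.

HB.instance Definition _ :=
  isHermitianSesquilinear.Build K _ false theta dsum_dot dsum_dot_herm.

Lemma dsum_dot_gt0 (f : dsum W) : f != 0 -> 0 < dsum_dot f f.
Proof.
move=> f0; have [i fi0] : exists i, vsval f i != 0.
  apply/existsP; apply: contraNT f0; rewrite negb_exists => /forallP h.
  apply/eqP/val_inj/ffunP => i; rewrite ffunE.
  by apply/eqP; rewrite -[_ == _]negbK h.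
rewrite /dsum_dot (bigD1 i)//= ltr_wpDr ?neq0_dnorm_gt0//.
apply: sumr_ge0 => j _; have [->|fj0] := eqVneq (vsval f j) 0.
  by rewrite linear0r.
exact/ltW/neq0_dnorm_gt0.
Qed.

HB.instance Definition _ := isDotProduct.Build K _ dsum_dot dsum_dot_gt0.

End Inner.

Arguments dsum_dot : clear implicits.

Section Operators.
Variables (W : I -> {vspace H}) (w : I -> K).

Definition synthesis : 'Hom(dsum W, H) :=
  linfun (fun f : dsum W => \sum_i w i *: vsval f i).

(* component i is p_i, block i is M_i; vsproj only retypes vectors that are   *)
(* already in the subspace, see componentE and blockE.                        *)
Definition component (i : I) : 'Hom(dsum W, subvs_of (W i)) :=
  linfun (fun f : dsum W => vsproj (W i) (vsval f i)).

Definition block (i : I) : 'End(dsum W) :=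
  linfun (fun f : dsum W =>
    vsproj (dsumv W) [ffun j => if j == i then vsval f j else 0]).

Lemma synthesisE (f : dsum W) : synthesis f = \sum_i w i *: vsval f i.
Proof.
apply: linfun_linearE => a g h; rewrite scaler_sumr -big_split/=.
apply: eq_bigr => i _; rewrite dsum_coordP scalerDr !scalerA.
by rewrite [a * _]mulrC.
Qed.

Lemma componentE i (f : dsum W) : vsval (component i f) = vsval f i.
Proof.
rewrite linfun_linearE ?vsprojK//; first exact/dsumvP/subvsP.
by move=> a g h; rewrite dsum_coordP linearP.
Qed.

Lemma blockE i (f : dsum W) j :
  vsval (block i f) j = if j == i then vsval f j else 0.
Proof.
rewrite linfun_linearE ?vsprojK ?ffunE//.
  apply/dsumvP => l; rewrite ffunE; case: eqP => _; last exact: mem0v.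
  exact/dsumvP/subvsP.
move=> a g h; rewrite -linearP; congr (vsproj _ _); apply/ffunP => l.
rewrite !ffunE; case: eqP => _; first by rewrite ?ffunE.
by rewrite scaler0 addr0.
Qed.

Lemma dsum_embedP i (x : H) : x \in W i ->
  exists2 e : dsum W, (forall j, vsval e j = if j == i then x else 0)
    & forall g : dsum W, dsum_dot W e g = form x (vsval g i).
Proof.
move=> xW; pose e := [ffun j => if j == i then x else 0].
have eW : e \in dsumv W.
  by apply/dsumvP => j; rewrite ffunE; case: eqP => [->|_] //; apply: mem0v.
exists (Subvs eW) => [j|g]; first by rewrite ffunE.
rewrite /dsum_dot (bigD1 i)//= ffunE eqxx big1 ?addr0// => j /negPf ji.
by rewrite ffunE ji linear0l.
Qed.

Lemma adjoint_synthesisE (f : H) i :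
  vsval (adjoint (dsum_dot W) form synthesis f) i
    = theta (w i) *: orthoproj form (W i) f.
Proof.
set g := adjoint _ _ _ f; have [piW piO] := orthoprojP form (W i) f.
have gW : vsval g i \in W i by apply/dsumvP/subvsP.
apply/eqP; rewrite -subr_eq0; set d := _ - _.
have dW : d \in W i by rewrite rpredB// rpredZ.
apply: contraT => /(neq0_dnorm_gt0 (s := form)).
have [e eE eg] := dsum_embedP dW.
suff -> : form d d = 0 by rewrite ltxx.
rewrite {2}/d linearBr/= -eg -adjointP synthesisE (bigD1 i)//= eE eqxx.
rewrite big1 ?addr0 => [|j /negPf ji]; last by rewrite eE ji scaler0.
rewrite linearZl_LR linearZr_LR/= rmorphK -mulrBr -linearBr/=.
by rewrite dotC piO// rmorph0 mulr0.
Qed.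

Lemma adjoint_componentE i (x : subvs_of (W i)) j :
  vsval (adjoint (dsum_dot W) (subvs_dot form (W i)) (component i) x) j
    = if j == i then vsval x else 0.
Proof.
have [e eE eg] := dsum_embedP (subvsP x).
suff <- : e = adjoint (dsum_dot W) (subvs_dot form (W i)) (component i) x.
  exact: eE.
set c := adjoint _ _ _ x.
have gc g : dsum_dot W g c = form (vsval g i) (vsval x).
  rewrite -(componentE i g); apply: esym.
  exact: (adjointP (dsum_dot W) (subvs_dot form (W i)) (component i) g x).
have ge g : dsum_dot W g e = form (vsval g i) (vsval x).
  by rewrite [LHS](dotC (dsum_dot W)) [form _ _]dotC -eg.
apply/eqP; rewrite -subr_eq0; apply/eqP.
apply: (dot_eq0 (fU := dsum_dot W)) => g.
by rewrite dotC linearBr/= gc ge subrr rmorph0.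
Qed.

Definition excess : nat := \dim (lker synthesis).

(* Over the complex numbers 0 < x and x <= y force x and y - x to be real.    *)
Definition fusion_frame : Prop :=
  (forall i, 0 < w i) /\
  exists A B : K, [/\ 0 < A, A <= B & forall f : H,
    A * form f f
      <= \sum_i w i ^+ 2 * form (orthoproj form (W i) f) (orthoproj form (W i) f)
      <= B * form f f].

Definition bounded_left_inverse (A : 'Hom(dsum W, H)) : Prop :=
  bounded_op (dsum_dot W) form A /\
  (A \o adjoint (dsum_dot W) form synthesis)%VF = \1%VF.

End Operators.

Section Duals.
Variables (W : I -> {vspace H}) (w : I -> K).
Variables (V : I -> {vspace H}) (v : I -> K).

Definition block_diagonal (Q : 'Hom(dsum W, dsum V)) : Prop :=
  forall i, (limg (Q \o block W i) <= limg (block V i))%VS.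

Definition component_preserving (Q : 'Hom(dsum W, dsum V)) : Prop :=
  forall i, limg (Q \o block W i) = limg (block V i).

Definition dual_fusion_frame (Q : 'Hom(dsum W, dsum V)) : Prop :=
  [/\ fusion_frame V v,
      bounded_op (dsum_dot W) (dsum_dot V) Q,
      (synthesis V v \o Q \o adjoint (dsum_dot W) form (synthesis W w))%VF = \1%VF
    & block_diagonal Q].

(* Qmap A is Q_A. It is meaningful when A maps the range of block W i into V i*)
(* for all i: the family below then belongs to dsumv V, see QmapE.            *)
Definition Qmap (A : 'Hom(dsum W, H)) : 'Hom(dsum W, dsum V) :=
  linfun (fun f : dsum W =>
    vsproj (dsumv V) [ffun i => (v i)^-1 *: A (block W i f)]).

Lemma QmapE (A : 'Hom(dsum W, H)) (f : dsum W) i :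
  (forall i, (limg (A \o block W i) <= V i)%VS) ->
  vsval (Qmap A f) i = (v i)^-1 *: A (block W i f).
Proof.
move=> AV; rewrite linfun_linearE ?vsprojK ?ffunE//.
  apply/dsumvP => j; rewrite ffunE memvZ//.
  by apply: (subvP (AV j)); rewrite -comp_lfunE memv_img ?memvf.
move=> a g h; rewrite -linearP; congr (vsproj _ _); apply/ffunP => j.
by rewrite !ffunE [block W j _]linearP [A _]linearP scalerDr !scalerA [a * _]mulrC.
Qed.

Definition dual_fusion_frame_of (A : 'Hom(dsum W, H)) : Prop :=
  (forall i, (limg (A \o block W i) <= V i)%VS) /\
  dual_fusion_frame (Qmap A).

End Duals.
End DirectSum.

Arguments dsum_dot {K theta I H} form W f g.

(* Main.v *)
Require Import Defs.
From mathcomp Require Import all_boot all_order all_algebra.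
From mathcomp Require Import reals.

(** The identities hold without the absolute values, and they only count
    dimensions.

    The adjoint of [A T_W^* = 1] is [T_W A^* = 1], so [T_W] is surjective and
    [e(W) = dim (dsum W) - n]; the duality [T_V Q T_W^* = 1] makes [T_V]
    surjective as well.  Therefore [e(V) - e(W) = dim (dsum V) - dim (dsum W)],
    which is the sum over [i] of [dim V_i - dim W_i] ([dim_dsum]).

    Both right-hand sides now come from a single form of the rank-nullity
    theorem ([dim_cap_lker_adjoint]): if a subspace [S] contains the range of
    [T], then [S] is the orthogonal sum of the range of [T] and of the
    intersection of [S] with the kernel of [T^*].  For [T = A p_i^*], whose
    adjoint is [p_i A^*], and [S = V_i], comparison with rank-nullity for [T]
    itself evaluates [dim V_i - dim W_i]; for [T = Q_A] and [S] the whole space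
    [dsum V], the same comparison evaluates [dim (dsum V) - dim (dsum W)]. *)

Set Implicit Arguments.
Unset Strict Implicit.
Unset Printing Implicit Defensive.

Import Order.TTheory GRing.Theory Num.Theory.

Local Open Scope ring_scope.

Section AdjointRank.
Variables (K : numFieldType) (theta : involutive_rmorphism K).
Variables (U V : vectType K).
Variables (fU : {dot U for theta}) (fV : {dot V for theta}).

Lemma adjointK (T : 'Hom(U, V)) : adjoint fV fU (adjoint fU fV T) = T.
Proof.
apply/esym/adjoint_unique => v u.
by rewrite dotC -(adjointP fU fV) [in RHS]dotC.
Qed.

Lemma adjoint_comp (X : vectType K) (fX : {dot X for theta})
    (T : 'Hom(U, V)) (S : 'Hom(X, U)) :
  adjoint fX fV (T \o S)%VF = (adjoint fX fU S \o adjoint fU fV T)%VF.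
Proof.
by apply/esym/adjoint_unique => x v; rewrite !comp_lfunE (adjointP fU fV) (adjointP fX fU).
Qed.

Lemma adjoint1 : adjoint fU fU \1%VF = \1%VF.
Proof. by apply/esym/adjoint_unique => u v; rewrite !id_lfunE. Qed.

(** If [T^* (T u) = 0] then [T u] is orthogonal to itself. *)
Lemma limg_cap_lker_adjoint (T : 'Hom(U, V)) :
  (limg T :&: lker (adjoint fU fV T) = 0)%VS.
Proof.
apply/eqP; rewrite -subv0; apply/subvP => _ /memv_capP[/memv_imgP[u _ ->]].
rewrite memv_ker memv0 => /eqP Tu0; apply: contraT.
by move=> /(neq0_dnorm_gt0 (s := fV)); rewrite (adjointP fU fV) Tu0 linear0r ltxx.
Qed.

Lemma dim_img_limg_adjoint (T : 'Hom(U, V)) :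
  \dim (adjoint fU fV T @: limg T) = \dim (limg T).
Proof. exact: limg_dim_eq (limg_cap_lker_adjoint T). Qed.

End AdjointRank.

Section RankNullity.
Variables (K : numFieldType) (theta : involutive_rmorphism K).
Variables (U V : vectType K).
Variables (fU : {dot U for theta}) (fV : {dot V for theta}).

Lemma dim_limg_adjoint (T : 'Hom(U, V)) :
  \dim (limg (adjoint fU fV T)) = \dim (limg T).
Proof.
(* [T^*] is injective on the range of [T], and [T = T^**] on that of [T^*]. *)
apply/eqP; rewrite eqn_leq; apply/andP; split.
  by rewrite -(dim_img_limg_adjoint fV fU) adjointK dimvS// limgS ?subvf.
by rewrite -(dim_img_limg_adjoint fU fV T) dimvS// limgS ?subvf.
Qed.

(** [T^*] maps [S] onto the range of [T^*], since it is already injective on the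
    range of [T], whose dimension is that of the range of [T^*]. *)
Lemma dim_cap_lker_adjoint (T : 'Hom(U, V)) (S : {vspace V}) :
  (limg T <= S)%VS ->
  (\dim (S :&: lker (adjoint fU fV T)) + \dim (limg T))%N = \dim S.
Proof.
move=> TS; rewrite -[RHS](limg_ker_dim (adjoint fU fV T)); congr addn.
apply/eqP; rewrite eqn_leq; apply/andP; split.
  by rewrite -(dim_img_limg_adjoint fU fV T) dimvS// limgS.
by rewrite -(dim_limg_adjoint T) dimvS// limgS ?subvf.
Qed.

Lemma dim_lker_limg (T : 'Hom(U, V)) :
  (\dim (lker T) + \dim (limg T))%N = \dim {:U}.
Proof. by rewrite -(limg_ker_dim T fullv) capfv. Qed.

Lemma limg_right_inverse (T : 'Hom(U, V)) (S : 'Hom(V, U)) :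
  (T \o S)%VF = \1%VF -> limg T = fullv.
Proof.
move=> TS; apply/eqP; rewrite eqEsubv subvf /=; apply/subvP => x _.
by rewrite -[x](id_lfunE (aT := V)) -TS comp_lfunE memv_img ?memvf.
Qed.

End RankNullity.

Section FusionFrames.
Variables (K : numFieldType) (theta : involutive_rmorphism K) (I : finType).
Variables (H : vectType K) (form : {dot H for theta}).

Section Embedding.
Variable W : I -> {vspace H}.

Let embedding (i : I) : 'Hom(subvs_of (W i), dsum W) :=
  adjoint (dsum_dot form W) (subvs_dot form (W i)) (component W i).

Let embeddingE i x j :
  vsval (embedding i x) j = if j == i then vsval x else 0.
Proof. exact: adjoint_componentE. Qed.

Lemma block_embedding i (x : subvs_of (W i)) :
  block W i (embedding i x) = embedding i x.
Proof.
apply: val_inj; apply/ffunP => j.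
by rewrite [LHS]blockE !embeddingE; case: eqP.
Qed.

(** The whole space is the direct sum of the ranges of the embeddings [p_i^*],
    and each embedding is injective. *)
Lemma dim_dsum : \dim {:dsum W} = (\sum_i \dim (W i))%N.
Proof.
have vsum (f : I -> dsum W) j :
    vsval (\sum_i f i) j = \sum_i vsval (f i) j.
  by rewrite linear_sum sum_ffunE.
have direct : directv (\sum_i limg (embedding i)).
  apply/directv_sum_independent => f fE f0 i _.
  have {}fE l j : vsval (f l) j = if j == l then vsval (f l) l else 0.
    have /memv_imgP[x _ ->] := fE l isT.
    by rewrite !embeddingE eqxx.
  apply: val_inj; apply/ffunP => j; rewrite [LHS]fE [RHS]ffunE.
  case: eqP => // _; have := vsum f i; rewrite f0 [LHS]ffunE.
  rewrite (bigD1 i)//= big1 ?addr0// => l li.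
  by rewrite fE eq_sym (negPf li).
have full : (\sum_i limg (embedding i))%VS = fullv.
  apply/eqP; rewrite eqEsubv subvf/=; apply/subvP => f _.
  have -> : f = \sum_i embedding i (component W i f).
    apply: val_inj; apply/ffunP => j; rewrite [RHS]vsum (bigD1 j)//= big1.
      by rewrite addr0 embeddingE eqxx componentE.
    by move=> i ij; rewrite embeddingE eq_sym (negPf ij).
  by apply: memv_sumr => i _; rewrite memv_img ?memvf.
rewrite -full (directvP direct); apply: eq_bigr => i _.
rewrite /= limg_dim_eq ?dimvf//; apply/eqP; rewrite -subv0 capfv.
apply/subvP => x; rewrite memv_ker memv0 => /eqP ex0.
apply/eqP; apply: val_inj; have := embeddingE x i.
by rewrite ex0 eqxx [LHS]ffunE => /esym.
Qed.

Lemma excess_surjective (w : I -> K) :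
  limg (synthesis W w) = fullv ->
  (excess W w + \dim {:H})%N = \dim {:dsum W}.
Proof. by move=> sT; rewrite -sT dim_lker_limg. Qed.

Lemma limg_synthesis (w : I -> K) (A : 'Hom(dsum W, H)) :
  bounded_left_inverse form w A -> limg (synthesis W w) = fullv.
Proof.
case=> _ AT1.
apply: (limg_right_inverse (S := adjoint (dsum_dot form W) form A)).
rewrite -[synthesis _ _](adjointK (dsum_dot form W) form).
by rewrite -adjoint_comp AT1 adjoint1.
Qed.

(** [dim S] and [dim W_i] both exceed one and the same rank, that of [A p_i^*]:
    the former by the kernel of the adjoint [p_i A^*] inside [S], the latter by
    the kernel of [A p_i^*].  The equation is written crosswise to avoid
    truncated subtraction. *)
Lemma dim_component_balance (A : 'Hom(dsum W, H)) (i : I) (S : {vspace H}) :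
  (limg (A \o block W i) <= S)%VS ->
  (\dim S + \dim (lker (A \o embedding i)%VF))%N
    = (\dim (S :&: lker (component W i \o adjoint (dsum_dot form W) form A))
       + \dim (W i))%N.
Proof.
move=> AS; have AeS : (limg (A \o embedding i) <= S)%VS.
  apply/subvP => _ /memv_imgP[x _ ->]; apply: (subvP AS).
  by rewrite comp_lfunE -block_embedding -comp_lfunE memv_img ?memvf.
have := dim_cap_lker_adjoint (subvs_dot form (W i)) form AeS.
rewrite (adjoint_comp (dsum_dot form W)) adjointK => <-.
have <- : (\dim (lker (A \o embedding i)) + \dim (limg (A \o embedding i)))%N
    = \dim (W i) by rewrite dim_lker_limg dimvf.
by rewrite -addnA [X in (_ + X)%N]addnC.
Qed.

End Embedding.
End FusionFrames.

Theorem theorem12 (R : realType) (k : scalar_kind) (n : nat)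
    (H : vectType (scalars R k)) (dimH : \dim {:H} = n)
    (form : {dot H for conjugation R k}) (I : finType)
    (W : I -> {vspace H}) (w : I -> scalars R k)
    (V : I -> {vspace H}) (v : I -> scalars R k)
    (A : 'Hom(dsum W, H)) :
  fusion_frame form W w ->
  bounded_left_inverse form w A ->
  dual_fusion_frame_of form w V v A ->
  `|(excess V v)%:Z - (excess W w)%:Z|
    = `|(\sum_(i : I)
           \dim (V i :&: lker (component W i
                                \o adjoint (dsum_dot form W) form A))%VS)%:Z
        - (\sum_(i : I)
             \dim (lker (A \o adjoint (dsum_dot form W)
                                        (subvs_dot form (W i))
                                        (component W i))%VF))%:Z|
  /\
  (component_preserving (Qmap V v A) ->
   `|(excess V v)%:Z - (excess W w)%:Z|
     = `|(\dim (lker (adjoint (dsum_dot form W) (dsum_dot form V)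
                               (Qmap V v A))))%:Z
         - (\dim (lker (Qmap V v A)))%:Z|).
Proof.
move=> _ AT1 [AV [_ _ TQT1 _]].
have eW := excess_surjective (limg_synthesis AT1).
have eV : (excess V v + \dim {:H})%N = \dim {:dsum V}.
  apply/excess_surjective/limg_right_inverse.
  by rewrite -comp_lfunA in TQT1; exact: TQT1.
have diffE (a b c d : nat) : (a + d = c + b)%N -> a%:Z - b%:Z = c%:Z - d%:Z.
  by move=> e; apply/eqP; rewrite subr_eq addrAC eq_sym subr_eq -!PoszD e.
split=> [|_]; congr `|_|; apply: diffE; apply: (@addIn (\dim {:H})).
  rewrite addnAC eV -addnA eW !(dim_dsum form) -!big_split /=.
  by apply: eq_bigr => i _; apply: dim_component_balance.
rewrite addnAC eV -addnA eW -(dim_lker_limg (Qmap V v A)).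
have := dim_cap_lker_adjoint (dsum_dot form W) (dsum_dot form V)
  (subvf (limg (Qmap V v A))).
by rewrite capfv => <-; rewrite -addnA [X in (_ + X)%N]addnC.
Qed.
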